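(* (1) $\ker(d:\mathfrak{tder}_2\to\mathfrak{tder}_3)=k\,r\oplus k\,t$, where $r=(y,0)$ and $t=(y,x)$. (2) $\ker(d:\mathfrak{tder}_3\to\mathfrak{tder}_4)/\mathrm{im}(d:\mathfrak{tder}_2\to\mathfrak{tder}_3)$ is one-dimensional, spanned by the class of $(0,[z,x],0)$.
   Context: $k$ is a field of characteristic zero; $\mathfrak{lie}_n$ is the degree completion of the free Lie algebra over $k$ on $x_1,\dots,x_n$ (written $x,y$ for $n=2$; $x,y,z$ for $n=3$; $x,y,z,w$ for $n=4$). $\mathfrak{tder}_n$ is the Lie algebra of derivations $u$ of $\mathfrak{lie}_n$ such that $u(x_i)=[x_i,a_i]$ for some $a_i\in\mathfrak{lie}_n$, $i=1,\dots,n$; $u$ is written $u=(a_1,\dots,a_n)$, the $a_i$ being normalized so that $a_i$ has zero coefficient of $x_i$ in degree one (this makes the tuple unique). Thus $r=(y,0)$ is the derivation $x\mapsto[x,y]$, $y\mapsto 0$, and $t=(y,x)$ is $x\mapsto[x,y]$, $y\mapsto[y,x]$. For $u=(a,b)\in\mathfrak{tder}_2$ define in $\mathfrak{tder}_3$: $u^{1,2}=(a(x,y),b(x,y),0)$, $u^{2,3}=(0,a(y,z),b(y,z))$, $u^{12,3}=(a(x+y,z),a(x+y,z),b(x+y,z))$, $u^{1,23}=(a(x,y+z),b(x,y+z),b(x,y+z))$, and $du=u^{2,3}-u^{12,3}+u^{1,23}-u^{1,2}$. For $u=(a,b,c)\in\mathfrak{tder}_3$ define in $\mathfrak{tder}_4$: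 $u^{1,2,3}=(a(x,y,z),b(x,y,z),c(x,y,z),0)$, $u^{2,3,4}=(0,a(y,z,w),b(y,z,w),c(y,z,w))$, $u^{12,3,4}=(a,a,b,c)$ each evaluated at $(x+y,z,w)$, $u^{1,23,4}=(a,b,b,c)$ each evaluated at $(x,y+z,w)$, $u^{1,2,34}=(a,b,c,c)$ each evaluated at $(x,y,z+w)$, and $du=u^{2,3,4}-u^{12,3,4}+u^{1,23,4}-u^{1,2,34}+u^{1,2,3}$. *)

(* Defs.v *)
From mathcomp Require Import all_boot all_algebra.
Set Implicit Arguments. Unset Strict Implicit. Unset Printing Implicit Defensive.
Import GRing.Theory.
Local Open Scope ring_scope.

(* The degree completion of the free associative algebra k<<x_0..x_{n-1}>>  *)
(* is the space of ALL functions from words (seq 'I_n) to k: a series f is  *)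
(* sum_w f(w) w.  The product is the Cauchy product over word splittings.   *)
Section Series.
Variable k : fieldType.

Definition series (n : nat) := seq 'I_n -> k.

Definition szero n : series n := fun _ => 0.
Definition sadd n (f g : series n) : series n := fun w => f w + g w.
Definition sopp n (f : series n) : series n := fun w => - f w.
Definition sscale n (c : k) (f : series n) : series n := fun w => c * f w.
Definition smul n (f g : series n) : series n :=
  fun w => \sum_(i < (size w).+1) f (take i w) * g (drop i w).
Definition sbr n (f g : series n) : series n :=
  sadd (smul f g) (sopp (smul g f)).
Definition sgen n (i : 'I_n) : series n :=
  fun w => if w == [:: i] then 1 else 0.
Definition shom n (m : nat) (f : series n) : series n :=
  fun w => if size w == m then f w else 0.

(* Lie polynomials: the Lie subalgebra (for the commutator) of the free
   associative algebra generated by the x_i; this is the free Lie algebra. *)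
Inductive lie_poly n : series n -> Prop :=
| lie_poly_zero : lie_poly (@szero n)
| lie_poly_gen (i : 'I_n) : lie_poly (sgen i)
| lie_poly_add f g : lie_poly f -> lie_poly g -> lie_poly (sadd f g)
| lie_poly_scale (c : k) f : lie_poly f -> lie_poly (sscale c f)
| lie_poly_br f g : lie_poly f -> lie_poly g -> lie_poly (sbr f g).

(* Elements of the degree completion lie_n of the free Lie algebra: series
   all of whose homogeneous components are Lie polynomials. *)
Definition is_lie n (f : series n) : Prop := forall m, lie_poly (shom m f).

(* Substitution of linear forms for the variables: x_i |-> sum_{j in s i} x_j
   (continuous algebra morphism on completed series). *)
Definition ssubst n m (s : 'I_n -> seq 'I_m) (f : series n) : series m :=
  fun w => \sum_(v : (size w).-tuple 'I_n)
              f v * \prod_(j < size w) ((tnth (in_tuple w) j \in s (tnth v j))%:R).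

(* Tuples u = (a_1,...,a_n) representing elements of tder_n *)
Definition tup n := 'I_n -> series n.
Definition tzero n : tup n := fun _ => @szero n.
Definition tadd n (u v : tup n) : tup n := fun i => sadd (u i) (v i).
Definition topp n (u : tup n) : tup n := fun i => sopp (u i).
Definition tscale n (c : k) (u : tup n) : tup n := fun i => sscale c (u i).

(* u is (the normalized tuple of) an element of tder_n: every a_i is in
   lie_n and a_i has zero coefficient of x_i in degree one. *)
Definition is_tder n (u : tup n) : Prop :=
  forall i, is_lie (u i) /\ u i [:: i] = 0.

Definition coface n m (s : 'I_n -> seq 'I_m) (p : 'I_m -> option 'I_n)
  (u : tup n) : tup m :=
  fun j => match p j with Some i => ssubst s (u i) | None => @szero m end.

End Series.
Arguments szero {k} n.
Arguments tzero {k} n.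
Arguments sgen {k n} i _.
Arguments sbr {k n} f g _.
Arguments is_tder {k n} u.
Arguments tadd {k n} u v _.
Arguments tscale {k n} c u _.
Arguments topp {k n} u _.
Arguments coface {k n m} s p u _.

(* Variables: for n=2, x = o2_0, y = o2_1; n=3: x,y,z = o3_0,o3_1,o3_2;
   n=4: x,y,z,w = o4_0,...,o4_3. *)
Definition o2_0 : 'I_2 := @Ordinal 2 0 isT.
Definition o2_1 : 'I_2 := @Ordinal 2 1 isT.
Definition o3_0 : 'I_3 := @Ordinal 3 0 isT.
Definition o3_1 : 'I_3 := @Ordinal 3 1 isT.
Definition o3_2 : 'I_3 := @Ordinal 3 2 isT.
Definition o4_0 : 'I_4 := @Ordinal 4 0 isT.
Definition o4_1 : 'I_4 := @Ordinal 4 1 isT.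
Definition o4_2 : 'I_4 := @Ordinal 4 2 isT.
Definition o4_3 : 'I_4 := @Ordinal 4 3 isT.

Section Cofaces.
Variable k : fieldType.

Definition u_1_2 (u : tup k 2) : tup k 3 :=
  coface (fun i : 'I_2 => match val i with 0 => [:: o3_0] | _ => [:: o3_1] end)
         (fun j : 'I_3 => match val j with 0 => Some o2_0 | 1 => Some o2_1 | _ => None end) u.
Definition u_2_3 (u : tup k 2) : tup k 3 :=
  coface (fun i : 'I_2 => match val i with 0 => [:: o3_1] | _ => [:: o3_2] end)
         (fun j : 'I_3 => match val j with 0 => None | 1 => Some o2_0 | _ => Some o2_1 end) u.
Definition u_12_3 (u : tup k 2) : tup k 3 :=
  coface (fun i : 'I_2 => match val i with 0 => [:: o3_0; o3_1] | _ => [:: o3_2] end)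
         (fun j : 'I_3 => match val j with 0 => Some o2_0 | 1 => Some o2_0 | _ => Some o2_1 end) u.
Definition u_1_23 (u : tup k 2) : tup k 3 :=
  coface (fun i : 'I_2 => match val i with 0 => [:: o3_0] | _ => [:: o3_1; o3_2] end)
         (fun j : 'I_3 => match val j with 0 => Some o2_0 | 1 => Some o2_1 | _ => Some o2_1 end) u.

Definition d2 (u : tup k 2) : tup k 3 :=
  tadd (tadd (tadd (u_2_3 u) (topp (u_12_3 u))) (u_1_23 u)) (topp (u_1_2 u)).

Definition u_1_2_3 (u : tup k 3) : tup k 4 :=
  coface (fun i : 'I_3 => match val i with 0 => [:: o4_0] | 1 => [:: o4_1] | _ => [:: o4_2] end)
         (fun j : 'I_4 => match val j with 0 => Some o3_0 | 1 => Some o3_1 | 2 => Some o3_2 | _ => None end) u.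
Definition u_2_3_4 (u : tup k 3) : tup k 4 :=
  coface (fun i : 'I_3 => match val i with 0 => [:: o4_1] | 1 => [:: o4_2] | _ => [:: o4_3] end)
         (fun j : 'I_4 => match val j with 0 => None | 1 => Some o3_0 | 2 => Some o3_1 | _ => Some o3_2 end) u.
Definition u_12_3_4 (u : tup k 3) : tup k 4 :=
  coface (fun i : 'I_3 => match val i with 0 => [:: o4_0; o4_1] | 1 => [:: o4_2] | _ => [:: o4_3] end)
         (fun j : 'I_4 => match val j with 0 => Some o3_0 | 1 => Some o3_0 | 2 => Some o3_1 | _ => Some o3_2 end) u.
Definition u_1_23_4 (u : tup k 3) : tup k 4 :=
  coface (fun i : 'I_3 => match val i with 0 => [:: o4_0] | 1 => [:: o4_1; o4_2] | _ => [:: o4_3] end)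
         (fun j : 'I_4 => match val j with 0 => Some o3_0 | 1 => Some o3_1 | 2 => Some o3_1 | _ => Some o3_2 end) u.
Definition u_1_2_34 (u : tup k 3) : tup k 4 :=
  coface (fun i : 'I_3 => match val i with 0 => [:: o4_0] | 1 => [:: o4_1] | _ => [:: o4_2; o4_3] end)
         (fun j : 'I_4 => match val j with 0 => Some o3_0 | 1 => Some o3_1 | 2 => Some o3_2 | _ => Some o3_2 end) u.

Definition d3 (u : tup k 3) : tup k 4 :=
  tadd (tadd (tadd (tadd (u_2_3_4 u) (topp (u_12_3_4 u))) (u_1_23_4 u))
             (topp (u_1_2_34 u))) (u_1_2_3 u).

Definition r_elt : tup k 2 :=
  fun i => match val i with 0 => sgen o2_1 | _ => szero 2 end.
Definition t_elt : tup k 2 :=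
  fun i => match val i with 0 => sgen o2_1 | _ => sgen o2_0 end.

Definition c_elt : tup k 3 :=
  fun i => match val i with 1 => sbr (sgen o3_2) (sgen o3_0) | _ => szero 3 end.

End Cofaces.

(* Main.v *)
(** A substitution x_i |-> (sum of a block of letters), the blocks being
    disjoint, pulls coefficients back along a partial map of letters; so every
    coface map is explicit on words, and setting a variable to zero amounts to
    restricting to the words that avoid it.

    In dimension 2, setting x = 0 in the first component of du = 0 and z = 0
    in the last one leaves only linear terms.  In dimension 3, if v = (a,b,c)
    is a cocycle, setting x = 0 in the first component and w = 0 in the last
    one of dv = 0 gives v = du + (0,b',0) with u = (- a(0,x,y), c(x,y,0)).
    The two middle components then say that b' = h(x,y+z) - h(x,y) where
    h(x,y) = b'(x,0,y) satisfies h(y,z) - h(x+y,z) + h(x,y+z) - h(x,y) = 0.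
    In degree m >= 3 this forces h to be constant on non-constant words; as h
    is Lie it vanishes on constant words and its coefficients sum to zero, so
    (2^m - 2) times the constant is zero.  Hence h is a multiple of [x,y]. *)

From Stdlib Require Import FunctionalExtensionality.
Require Import Defs.
From mathcomp Require Import all_boot all_algebra ring.
Import GRing.Theory.
Local Open Scope ring_scope.

Set Implicit Arguments.
Unset Strict Implicit.
Unset Printing Implicit Defensive.

Lemma ord2_case (P : 'I_2 -> Prop) : P o2_0 -> P o2_1 -> forall i, P i.
Proof.
move=> P0 P1 [[|[|//]] Hi].
- by rewrite (_ : Ordinal Hi = o2_0) //; apply: val_inj.
- by rewrite (_ : Ordinal Hi = o2_1) //; apply: val_inj.
Qed.

Lemma ord3_case (P : 'I_3 -> Prop) :
  P o3_0 -> P o3_1 -> P o3_2 -> forall i, P i.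
Proof.
move=> P0 P1 P2 [[|[|[|//]]] Hi].
- by rewrite (_ : Ordinal Hi = o3_0) //; apply: val_inj.
- by rewrite (_ : Ordinal Hi = o3_1) //; apply: val_inj.
- by rewrite (_ : Ordinal Hi = o3_2) //; apply: val_inj.
Qed.

Lemma ord4_case (P : 'I_4 -> Prop) :
  P o4_0 -> P o4_1 -> P o4_2 -> P o4_3 -> forall i, P i.
Proof.
move=> P0 P1 P2 P3 [[|[|[|[|//]]]] Hi].
- by rewrite (_ : Ordinal Hi = o4_0) //; apply: val_inj.
- by rewrite (_ : Ordinal Hi = o4_1) //; apply: val_inj.
- by rewrite (_ : Ordinal Hi = o4_2) //; apply: val_inj.
- by rewrite (_ : Ordinal Hi = o4_3) //; apply: val_inj.
Qed.

Section Pullback.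
Variable k : fieldType.

(* [pull p f] is [f] with [x_i] replaced by the sum of all letters [j] such
   that [p j = Some i]; a letter with [p j = None] does not occur. *)
Definition pull m n (p : 'I_m -> option 'I_n) (f : series k n) : series k m :=
  fun w => if all p w then f (pmap p w) else 0.

Definition lmap m n (s : seq (option 'I_n)) : 'I_m -> option 'I_n :=
  fun j => nth None s j.

Lemma ssubst_pull m n (s : 'I_n -> seq 'I_m) (p : 'I_m -> option 'I_n) f :
  (forall j i, (j \in s i) = (p j == Some i)) -> @ssubst k n m s f = pull p f.
Proof.
move=> sp; apply: functional_extensionality => w; rewrite /ssubst /pull.
case: ifP => [pw|/negbT].
  have sz : size (pmap p w) == size w by rewrite size_pmap -all_count.
  have pE j : p (tnth (in_tuple w) j) = Some (tnth (Tuple sz) j).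
    rewrite (tnth_nth (tnth (in_tuple w) j)) (tnth_nth (tnth (Tuple sz) j)) /=.
    move: (tnth _ j) (tnth _ j) (ltn_ord j) pw => x0 y0; move: (nat_of_ord j).
    elim: (w) => [|a l IH] // [|i] /= ; case: (p a) => //= b lti lw.
    by apply: IH.
  rewrite (bigD1 (Tuple sz)) //= [X in _ + X]big1 ?addr0 => [|v vn].
    by rewrite big1 ?mulr1 // => j _; rewrite sp pE eqxx.
  have [j jv] : exists j, tnth v j != tnth (Tuple sz) j.
    apply/existsP; apply: contraR vn; rewrite negb_exists => /forallP vE.
    by apply/eqP/eq_from_tnth => j; apply/eqP/negPn/vE.
  rewrite (bigD1 j) //= sp pE (inj_eq Some_inj) eq_sym (negbTE jv).
  by rewrite mul0r mulr0.
rewrite -has_predC => /hasP [a aw /= pa].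
have [j ja] : exists j, tnth (in_tuple w) j = a.
  by have /tnthP [j ->] : a \in in_tuple w; [|exists j].
rewrite big1 // => v _; rewrite (bigD1 j) //= sp ja.
by case: (p a) pa => // _; rewrite mul0r mulr0.
Qed.

Lemma pull_ext m n (p q : 'I_m -> option 'I_n) f :
  p =1 q -> pull p f = pull q f.
Proof. by move=> /functional_extensionality ->. Qed.

Lemma pull_comp l m n (p : 'I_l -> option 'I_m) (q : 'I_m -> option 'I_n) f :
  pull p (pull q f) = pull (fun j => obind q (p j)) f.
Proof.
apply: functional_extensionality => w; rewrite /pull.
have -> : all (fun j => obind q (p j)) w = all p w && all q (pmap p w).
  elim: w => //= a w ->; case: (p a) => //= b.
  by case: (isSome (q b)); rewrite /= ?andbF.
case: ifP => //= _; case: ifP => // _; congr f.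
by elim: w => //= a w IH; case: (p a) => //= b; rewrite -IH; case: (q b).
Qed.

Lemma pull_lmap l m n (s : seq (option 'I_m)) (t : seq (option 'I_n)) f :
  pull (lmap (m := l) s) (pull (lmap t) f)
  = pull (lmap [seq obind (lmap t) o | o <- s]) f.
Proof.
rewrite pull_comp; apply: pull_ext => j; rewrite /lmap.
have [lt|ge] := ltnP j (size s); first by rewrite (nth_map None).
by rewrite !nth_default ?size_map.
Qed.

Lemma pull0 m n (p : 'I_m -> option 'I_n) : pull p (@szero k n) = szero m.
Proof. by apply: functional_extensionality => w; rewrite /pull if_same. Qed.

Lemma pullD m n (p : 'I_m -> option 'I_n) f g :
  pull p (sadd f g) = sadd (pull p f) (pull p g).
Proof.
apply: functional_extensionality => w; rewrite /pull /sadd.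
by case: ifP; rewrite ?addr0.
Qed.

Lemma pullN m n (p : 'I_m -> option 'I_n) f :
  pull p (sopp f) = sopp (pull p f).
Proof.
apply: functional_extensionality => w; rewrite /pull /sopp.
by case: ifP; rewrite ?oppr0.
Qed.

Lemma pullZ m n (p : 'I_m -> option 'I_n) c f :
  pull p (sscale c f) = sscale c (pull p f).
Proof.
apply: functional_extensionality => w; rewrite /pull /sscale.
by case: ifP; rewrite ?mulr0.
Qed.

Lemma pull_mul m n (p : 'I_m -> option 'I_n) f g :
  pull p (smul f g) = smul (pull p f) (pull p g).
Proof.
apply: functional_extensionality => w; rewrite /pull /smul.
case: ifP => [pw|pw].
  have sz : size (pmap p w) = size w by rewrite size_pmap; apply/eqP; rewrite -all_count.
  rewrite sz; apply: eq_bigr => i _.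
  have pE : pmap p w = pmap p (take i w) ++ pmap p (drop i w).
    by rewrite -pmap_cat cat_take_drop.
  move: pw; rewrite -{1}(cat_take_drop i w) all_cat => /andP [pt pd].
  have szt : size (pmap p (take i w)) = i.
    rewrite size_pmap; move: (pt); rewrite all_count => /eqP ->.
    by rewrite size_takel // -ltnS.
  by rewrite pt pd pE -{1 3}szt take_size_cat // drop_size_cat.
rewrite big1 // => i _.
move: pw; rewrite -{1}(cat_take_drop i w) all_cat.
by case: (all p (take i w)) => //= [->|]; rewrite ?mulr0 ?mul0r.
Qed.

Lemma pull_br m n (p : 'I_m -> option 'I_n) f g :
  pull p (sbr f g) = sbr (pull p f) (pull p g).
Proof. by rewrite /sbr pullD pullN !pull_mul. Qed.

Lemma shom_pull m n (p : 'I_m -> option 'I_n) d f :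
  shom d (pull p f) = pull p (shom d f).
Proof.
apply: functional_extensionality => w; rewrite /pull /shom.
case: ifP => sz; case: ifP => // pw; move: (pw); rewrite all_count.
  by rewrite size_pmap => /eqP ->; rewrite sz.
by rewrite size_pmap => /eqP ->; rewrite sz.
Qed.

Lemma pull_id n f : pull Some f = f :> series k n.
Proof.
apply: functional_extensionality => w; rewrite /pull all_predT.
by congr f; elim: w => //= a w ->.
Qed.

Lemma lie_poly_sum n (I : eqType) (r : seq I) (F : I -> series k n) :
  (forall i, lie_poly (F i)) -> lie_poly (fun w => \sum_(i <- r) F i w).
Proof.
move=> LF; elim: r => [|i r IH].
  rewrite (_ : (fun _ => _) = @szero k n); first exact: lie_poly_zero.
  by apply: functional_extensionality => w; rewrite big_nil.
rewrite (_ : (fun _ => _) = sadd (F i) (fun w => \sum_(i <- r) F i w)).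
  exact: lie_poly_add.
by apply: functional_extensionality => w; rewrite big_cons.
Qed.

Lemma pull_gen m n (p : 'I_m -> option 'I_n) i :
  pull p (sgen i)
  = fun w => \sum_(j <- [seq j <- enum 'I_m | p j == Some i]) @sgen k m j w.
Proof.
apply: functional_extensionality => w; rewrite /pull /sgen big_filter.
rewrite big_enum_cond /=.
case: w => [|a [|b w]] /=.
- by rewrite big1.
- rewrite andbT; case E: (p a) => [c|] /=; last first.
    rewrite big1 // => j /eqP pj; case: eqP => // -[aj].
    by rewrite -aj E in pj.
  have [ci|ci] := boolP (c == i).
    rewrite (eqP ci) eqxx (bigD1 a) ?E ?(eqP ci) //= eqxx big1 ?addr0 // => j.
    by case/andP=> _ ja; rewrite eqseq_cons andbT eq_sym (negbTE ja).
  rewrite eqseq_cons andbT (negbTE ci) big1 // => j /eqP pj.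
  rewrite eqseq_cons andbT; case: eqP => // aj.
  by move: pj ci; rewrite -aj E => -[->]; rewrite eqxx.
- rewrite big1; last by move=> j _; rewrite eqseq_cons andbF.
  case: (p a) => [c|] //=; case: (p b) => [d|] //=.
  by rewrite eqseq_cons andbF if_same.
Qed.

Lemma lie_poly_pull m n (p : 'I_m -> option 'I_n) f :
  lie_poly f -> lie_poly (pull p f).
Proof.
elim=> [|i|g h _ Lg _ Lh|c g _ Lg|g h _ Lg _ Lh].
- by rewrite pull0; apply: lie_poly_zero.
- by rewrite pull_gen; apply: lie_poly_sum => j; apply: lie_poly_gen.
- by rewrite pullD; apply: lie_poly_add.
- by rewrite pullZ; apply: lie_poly_scale.
- by rewrite pull_br; apply: lie_poly_br.
Qed.

Lemma is_lie_pull m n (p : 'I_m -> option 'I_n) f :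
  is_lie f -> is_lie (pull p f).
Proof. by move=> Lf d; rewrite shom_pull; apply: lie_poly_pull. Qed.

Lemma is_lie0 n : is_lie (@szero k n).
Proof.
move=> d; rewrite (_ : shom d _ = @szero k n); first exact: lie_poly_zero.
by apply: functional_extensionality => w; rewrite /shom if_same.
Qed.

Lemma is_lieD n (f g : series k n) : is_lie f -> is_lie g -> is_lie (sadd f g).
Proof.
move=> Lf Lg d; rewrite (_ : shom d _ = sadd (shom d f) (shom d g)).
  exact: lie_poly_add.
apply: functional_extensionality => w; rewrite /shom /sadd.
by case: ifP; rewrite ?addr0.
Qed.

Lemma is_lieZ n c (f : series k n) : is_lie f -> is_lie (sscale c f).
Proof.
move=> Lf d; rewrite (_ : shom d _ = sscale c (shom d f)).
  exact: lie_poly_scale.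
apply: functional_extensionality => w; rewrite /shom /sscale.
by case: ifP; rewrite ?mulr0.
Qed.

Lemma is_lieN n (f : series k n) : is_lie f -> is_lie (sopp f).
Proof.
move=> Lf; rewrite (_ : sopp f = sscale (-1) f); first exact: is_lieZ.
by apply: functional_extensionality => w; rewrite /sopp /sscale mulN1r.
Qed.

Lemma is_lie_homog n d (f : series k n) :
  lie_poly f -> (forall w, size w != d -> f w = 0) -> is_lie f.
Proof.
move=> Lf f0 e; have [->|ne] := eqVneq e d.
  rewrite (_ : shom d f = f) //; apply: functional_extensionality => w.
  by rewrite /shom; case: ifPn => // /f0.
rewrite (_ : shom e f = @szero k n); first exact: lie_poly_zero.
apply: functional_extensionality => w; rewrite /shom; case: eqP => // sz.
by rewrite f0 // sz.
Qed.

Lemma smulC1 (f g : series k 1) : smul f g = smul g f.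
Proof.
have one (v w : seq 'I_1) : size v = size w -> v = w.
  by elim: v w => [|a v IH] [|b w] //= [/IH ->]; rewrite (ord1 a) (ord1 b).
apply: functional_extensionality => w; rewrite /smul (reindex_inj rev_ord_inj) /=.
apply: eq_bigr => i _; rewrite mulrC subSS; have le : (i <= size w)%N by rewrite -ltnS.
by congr (g _ * f _); apply: one; rewrite ?size_drop ?size_takel ?leq_subr ?subKn.
Qed.

Lemma lie_poly1 (f : series k 1) : lie_poly f -> exists c, f = sscale c (sgen ord0).
Proof.
have eqf (g h : series k 1) : g =1 h -> g = h by apply: functional_extensionality.
elim=> [|i|g h _ [c ->] _ [d ->]|c g _ [d ->]|g h _ _ _ _].
- by exists 0; apply: eqf => w; rewrite /sscale mul0r.
- by exists 1; apply: eqf => w; rewrite /sscale mul1r (ord1 i).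
- by exists (c + d); apply: eqf => w; rewrite /sscale /sadd mulrDl.
- by exists (c * d); apply: eqf => w; rewrite /sscale mulrA.
- exists 0; rewrite /sbr (smulC1 h); apply: eqf => w.
  by rewrite /sscale /sadd /sopp subrr mul0r.
Qed.

Lemma is_lie1 (f : series k 1) w : is_lie f -> size w != 1 -> f w = 0.
Proof.
move=> Lf sz; have [c] := lie_poly1 (Lf (size w)).
move=> /(congr1 (fun g => g w)); rewrite /shom eqxx => ->.
rewrite /sscale /sgen; case: eqP => [wE|]; last by rewrite mulr0.
by rewrite wE in sz.
Qed.

Lemma is_lie_const n (f : series k n) i d :
  is_lie f -> d != 1 -> f (nseq d i) = 0.
Proof.
move=> Lf d1; have := @is_lie1 (pull (fun _ => Some i) f) (nseq d ord0).
rewrite size_nseq => /(_ (is_lie_pull _ Lf) d1); rewrite /pull all_predT.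
by congr (f _ = _); elim: d {d1} => //= d ->.
Qed.

Lemma is_lie_nil n (f : series k n) : is_lie f -> f [::] = 0.
Proof.
case: n f => [|n] f Lf; last exact: (@is_lie_const _ f ord0 0).
suff g0 (g : series k 0) : lie_poly g -> g [::] = 0 by have := g0 _ (Lf 0).
elim=> [|[]|g1 g2 _ e1 _ e2|c g1 _ e1|g1 g2 _ e1 _ e2] //.
- by rewrite /sadd e1 e2 addr0.
- by rewrite /sscale e1 mulr0.
- by rewrite /sbr /sadd /sopp /smul !big_ord1 /= e1 mul0r mulr0 subrr.
Qed.

Fixpoint wsum n d (f : series k n) : k :=
  if d is d'.+1 then \sum_i wsum d' (fun w => f (i :: w)) else f [::].

Lemma eq_wsum n d (f g : series k n) :
  (forall w, size w = d -> f w = g w) -> wsum d f = wsum d g.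
Proof.
elim: d f g => [|d IH] f g fg /=; first exact: fg.
by apply: eq_bigr => i _; apply: IH => w sz; apply: fg; rewrite /= sz.
Qed.

Lemma wsum_lin n d (f g : series k n) c :
  wsum d (fun w => f w + c * g w) = wsum d f + c * wsum d g.
Proof.
elim: d f g => [|d IH] f g //=.
by rewrite big_distrr -big_split; apply: eq_bigr => i _; rewrite IH.
Qed.

Lemma wsum_mul n d (f g : series k n) :
  wsum d (smul f g) = \sum_(i < d.+1) wsum i f * wsum (d - i) g.
Proof.
elim: d f g => [|d IH] f g; first by rewrite /= /smul !big_ord1.
rewrite big_ord_recl /= mulr_sumr.
under [X in _ = _ + X]eq_bigr do rewrite mulr_suml.
rewrite exchange_big -big_split /=; apply: eq_bigr => i _.
rewrite (@eq_wsum _ _ _ (fun w => smul (fun v => f (i :: v)) g w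
                                  + f [::] * g (i :: w))).
  by rewrite wsum_lin IH addrC.
by move=> w _; rewrite /smul big_ord_recl /= addrC.
Qed.

Lemma wsum_lie n d (f : series k n) : is_lie f -> d != 1 -> wsum d f = 0.
Proof.
move=> Lf d1; rewrite (@eq_wsum _ _ _ (shom d f)); last first.
  by move=> w sz; rewrite /shom sz eqxx.
elim: (Lf d) => [|i|g h _ e1 _ e2|c g _ e|g h _ _ _ _].
- elim: (d) => //= e IH; exact: big1.
- rewrite (@eq_wsum _ _ _ (fun w => 0 + 0 * 0)) ?(wsum_lin _ _ (fun=> 0)).
    rewrite mul0r addr0; elim: (d) => //= e IH; exact: big1.
  move=> w sz; rewrite /sgen mul0r addr0; case: eqP => // wE.
  by rewrite -sz wE in d1.
- rewrite (@eq_wsum _ _ _ (fun w => g w + 1 * h w)).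
    by rewrite wsum_lin e1 e2 mulr0 addr0.
  by move=> w _; rewrite mul1r.
- rewrite (@eq_wsum _ _ _ (fun w => szero n w + c * g w)).
    rewrite wsum_lin e mulr0 addr0.
    elim: (d) => //= e' IH; exact: big1.
  by move=> w _; rewrite add0r.
- rewrite (@eq_wsum _ _ _ (fun w => smul g h w + -1 * smul h g w)).
    rewrite wsum_lin !wsum_mul mulN1r [X in _ - X](reindex_inj rev_ord_inj) /=.
    apply/eqP; rewrite subr_eq0; apply/eqP/eq_bigr => i _.
    by rewrite mulrC subSS subKn // -ltnS.
  by move=> w _; rewrite mulN1r.
Qed.

End Pullback.

Arguments lmap m n s j /.

Section LieCocycle.
Variable k : fieldType.

Lemma smul_gen n i (g : series k n) w :
  smul (sgen i) g w = if w is a :: v then (a == i)%:R * g v else 0.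
Proof.
rewrite /smul /sgen; case: w => [|a w]; first by rewrite big_ord1 /= mul0r.
rewrite !big_ord_recl /= mul0r add0r take0 drop0 big1 ?addr0 => [|j _].
  by rewrite eqseq_cons andbT; case: eqP.
rewrite /= /bump /=; case: w j => [[//]|b w] j.
by rewrite !add1n /= eqseq_cons andbF mul0r.
Qed.

Lemma sbr_gen n (i j : 'I_n) w :
  sbr (sgen i) (sgen j) w = (w == [:: i; j])%:R - (w == [:: j; i])%:R :> k.
Proof.
rewrite /sbr /sadd /sopp !smul_gen /sgen.
case: w => [|a w]; first by rewrite subr0.
by rewrite !eqseq_cons; congr (_ - _); case: (a == _); case: (w == _);
  rewrite ?(mulr0, mul0r, mulr1).
Qed.

Lemma wsum_nseq n (i : 'I_n) d : wsum d (fun w => (w == nseq d i)%:R) = 1 :> k.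
Proof.
elim: d => //= d IH; rewrite (bigD1 i) //= big1 ?addr0 => [|j ji].
  by rewrite -[RHS]IH; apply: eq_wsum => w _; rewrite eqseq_cons eqxx.
rewrite (@eq_wsum _ _ _ _ (fun _ => 0)) => [|w _].
  by elim: (d) => //= e IHe; apply: big1.
by rewrite eqseq_cons (negbTE ji).
Qed.

Lemma wsum_const n d : wsum d (fun _ : seq 'I_n => 1) = (n ^ d)%:R :> k.
Proof.
elim: d => //= d IH; under eq_bigr do rewrite IH.
by rewrite sumr_const card_ord -mulrnA expnSr.
Qed.

Variable h : series k 2.
Hypothesis h_lie : is_lie h.
Hypothesis h_cocycle : forall w : seq 'I_3,
  pull (lmap [:: None; Some o2_0; Some o2_1]) h w
  - pull (lmap [:: Some o2_0; Some o2_0; Some o2_1]) h w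
  + pull (lmap [:: Some o2_0; Some o2_1; Some o2_1]) h w
  - pull (lmap [:: Some o2_0; Some o2_1; None]) h w = 0.

Let word (F : pred nat) m := mkseq (fun i => if F i then o2_1 else o2_0) m.

Let wordK (w : seq 'I_2) : word (fun i => nth o2_0 w i == o2_1) (size w) = w.
Proof.
rewrite -[RHS](mkseq_nth o2_0); apply: eq_map => i.
by move: (nth _ _ _); apply: ord2_case.
Qed.

(* On a word containing both x and z only the two middle terms of the
   cocycle equation survive: sending all the letters y to x or to y does not
   change the coefficient. *)
Let word_le (F G : pred nat) m i j :
  (forall l, F l -> G l) -> (i < m)%N -> F i -> (j < m)%N -> ~~ G j ->
  h (word F m) = h (word G m).
Proof.
move=> FG im Fi jm Gj.
pose u := mkseq (fun l => if F l then o3_2 else if G l then o3_1 else o3_0) m.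
have u0 : o3_0 \in u.
  apply/mapP; exists j; first by rewrite mem_iota.
  by rewrite (negbTE Gj); case: ifP => // /FG; rewrite (negbTE Gj).
have u2 : o3_2 \in u by apply/mapP; exists i; rewrite ?mem_iota ?Fi.
have pE (p : seq (option 'I_2)) (g : nat -> 'I_2) :
    (forall l, nth None p (if F l then o3_2 else if G l then o3_1 else o3_0)
               = Some (g l)) ->
    pull (lmap p) h u = h (mkseq g m).
  move=> pg; rewrite /pull; have [-> -> //] : all (lmap (m := 3) p) u
      /\ pmap (lmap p) u = mkseq g m.
  rewrite /u /mkseq; elim: (iota 0 m) => //= l s [IH1 IH2].
  by rewrite /= pg /= IH1 IH2.
have := h_cocycle u.
have -> : pull (lmap [:: None; Some o2_0; Some o2_1]) h u = 0.
  by rewrite /pull; case: ifP => // /allP/(_ _ u0).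
have -> : pull (lmap [:: Some o2_0; Some o2_1; None]) h u = 0.
  by rewrite /pull; case: ifP => // /allP/(_ _ u2).
rewrite (pE _ (fun l => if F l then o2_1 else o2_0)); last first.
  by move=> l; case: (F l); case: (G l).
rewrite (pE _ (fun l => if G l then o2_1 else o2_0)); last first.
  by move=> l; case: (F l) (FG l) => [->|_] //; case: (G l).
by rewrite add0r subr0 => /eqP; rewrite addrC subr_eq0 => /eqP.
Qed.

Let cocycle_nonconst w : (2 < size w)%N -> o2_0 \in w -> o2_1 \in w ->
  h w = h (word (pred1 0) (size w)).
Proof.
move=> w3 w0 w1; set m := size w.
have unit_word j : (j < m)%N -> h (word (pred1 j) m) = h (word (pred1 0) m).
  move=> jm; have /hasP [i] : has (fun i => ~~ pred2 0 j i) (iota 0 3).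
    by case: (j) => [|[|[|?]]].
  rewrite mem_iota => /andP [_ i3] ij; have im : (i < m)%N by apply: leq_trans i3 w3.
  transitivity (h (word (pred2 0 j) m)).
    apply: (@word_le _ _ _ j i) => //; last by rewrite /= eqxx.
    by move=> l /= /eqP ->; rewrite eqxx orbT.
  symmetry; apply: (@word_le _ _ _ 0 i) => //.
  - by move=> l /= ->.
  - exact: leq_ltn_trans im.
rewrite -{1}(wordK w) -/m -(unit_word (index o2_1 w)) ?index_mem //.
symmetry; apply: (@word_le _ _ _ (index o2_1 w) (index o2_0 w)) => //=.
- by move=> l /eqP ->; rewrite nth_index.
- by rewrite index_mem.
- by rewrite index_mem.
- by rewrite nth_index.
Qed.

Lemma lie_cocycle (chark0 : [pchar k] =i pred0) :
  h = sscale (h [:: o2_0; o2_1]) (sbr (sgen o2_0) (sgen o2_1)).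
Proof.
have h1 a : h [:: a] = 0.
  apply: (@ord2_case (fun a => h [:: a] = 0)).
  - by have := h_cocycle [:: o3_0];
    rewrite /pull /= sub0r addNr sub0r => /eqP;
    rewrite oppr_eq0 => /eqP.
  - by have := h_cocycle [:: o3_2]; rewrite /pull /= subrr add0r subr0.
have h3 w : (2 < size w)%N -> h w = 0.
  move=> w3; set m := size w in w3 *; set c := h (word (pred1 0) m).
  have m1 : m != 1 by case: (m) w3 => [|[]].
  have hE v : size v = m -> h v = 0 + c * (1 + -1 *
      ((v == nseq m o2_0)%:R + 1 * (v == nseq m o2_1)%:R)).
    move=> vm; have [v0|v0] := boolP (o2_0 \in v); last first.
      have vE : v = nseq m o2_1.
        rewrite -vm; apply/all_pred1P/allP => b bv; apply/eqP.
        by move: b bv; apply: ord2_case => // bv; rewrite bv in v0.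
      rewrite vE is_lie_const // eqxx; case: eqP => [|_]; last by rewrite /=; ring.
      by case: (m) w3.
    have [v1|v1] := boolP (o2_1 \in v); last first.
      have vE : v = nseq m o2_0.
        rewrite -vm; apply/all_pred1P/allP => b bv; apply/eqP.
        by move: b bv; apply: ord2_case => // bv; rewrite bv in v1.
      rewrite vE is_lie_const // eqxx; case: eqP => [|_]; last by rewrite /=; ring.
      by case: (m) w3.
    rewrite cocycle_nonconst ?vm // -/c.
    case: eqP => [vE|_]; first by rewrite vE mem_nseq andbC in v1.
    case: eqP => [vE|_]; first by rewrite vE mem_nseq andbC in v0.
    by rewrite /=; ring.
  have := wsum_lie h_lie m1; rewrite (eq_wsum hE) !wsum_lin !wsum_nseq wsum_const.
  have -> : wsum m (fun _ : seq 'I_2 => 0) = 0 :> k.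
    by elim: (m) => //= e IH; apply: big1.
  rewrite add0r mul1r mulN1r -(natrD _ 1 1) -natrB; last first.
    by case: (m) w3 => // e e2; rewrite expnS leq_pmulr // expn_gt0.
  move=> /eqP; rewrite mulf_eq0 ((pcharf0P k).1 chark0) subn_eq0 leqNgt.
  have -> : (1 + 1 < 2 ^ m)%N by rewrite (@ltn_exp2l 2 1 m isT) ltnW.
  rewrite orbF => /eqP c0.
  by rewrite (hE w) // c0 mul0r addr0.
apply: functional_extensionality => -[|a [|b [|c w]]]; rewrite /sscale sbr_gen.
- by rewrite (is_lie_nil h_lie) subrr mulr0.
- by rewrite h1 !eqseq_cons !andbF subrr mulr0.
- have s2 := @wsum_lie _ _ 2 _ h_lie isT.
  rewrite /= !big_ord_recl !big_ord0 /= in s2.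
  have h00 := @is_lie_const _ _ _ o2_0 2 h_lie isT.
  have h11 := @is_lie_const _ _ _ o2_1 2 h_lie isT.
  have e0 : ord0 = o2_0 by apply: val_inj.
  have e1 : lift ord0 ord0 = o2_1 by apply: val_inj.
  rewrite e1 e0 h00 h11 !addr0 add0r in s2.
  move: a b; apply: ord2_case; apply: ord2_case; rewrite ?h00 ?h11 !eqseq_cons /=.
  + by rewrite subrr mulr0.
  + by rewrite subr0 mulr1.
  + by rewrite sub0r mulrN1; apply/eqP; rewrite -addr_eq0 addrC s2.
  + by rewrite subrr mulr0.
- by rewrite h3 // !eqseq_cons !andbF subrr mulr0.
Qed.

End LieCocycle.

Section Differentials.
Variable k : fieldType.

Local Notation X2 := (Some o2_0).
Local Notation Y2 := (Some o2_1).
Local Notation X3 := (Some o3_0).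
Local Notation Y3 := (Some o3_1).
Local Notation Z3 := (Some o3_2).
Local Notation "- f" := (sopp f) : series_scope.
Local Notation "f + g" := (sadd f g) : series_scope.
Delimit Scope series_scope with S.

Lemma d2E (u : tup k 2) :
  let a := u o2_0 in let b := u o2_1 in
  [/\ d2 u o3_0 = (szero 3 + - pull (lmap [:: X2; X2; Y2]) a
                   + pull (lmap [:: X2; Y2; Y2]) a
                   + - pull (lmap [:: X2; Y2; None]) a)%S,
      d2 u o3_1 = (pull (lmap [:: None; X2; Y2]) a
                   + - pull (lmap [:: X2; X2; Y2]) a
                   + pull (lmap [:: X2; Y2; Y2]) b
                   + - pull (lmap [:: X2; Y2; None]) b)%S &
      d2 u o3_2 = (pull (lmap [:: None; X2; Y2]) b
                   + - pull (lmap [:: X2; X2; Y2]) b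
                   + pull (lmap [:: X2; Y2; Y2]) b
                   + - szero 3)%S].
Proof.
rewrite /d2 /tadd /topp /u_2_3 /u_12_3 /u_1_23 /u_1_2 /coface /=.
by split; do !congr (sadd _ _); try congr (sopp _); rewrite //;
  apply: ssubst_pull; apply: ord3_case; apply: ord2_case.
Qed.

Lemma d3E (v : tup k 3) :
  let a := v o3_0 in let b := v o3_1 in let c := v o3_2 in
  [/\ d3 v o4_0 = (szero 4 + - pull (lmap [:: X3; X3; Y3; Z3]) a
                   + pull (lmap [:: X3; Y3; Y3; Z3]) a
                   + - pull (lmap [:: X3; Y3; Z3; Z3]) a
                   + pull (lmap [:: X3; Y3; Z3; None]) a)%S,
      d3 v o4_1 = (pull (lmap [:: None; X3; Y3; Z3]) a
                   + - pull (lmap [:: X3; X3; Y3; Z3]) a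
                   + pull (lmap [:: X3; Y3; Y3; Z3]) b
                   + - pull (lmap [:: X3; Y3; Z3; Z3]) b
                   + pull (lmap [:: X3; Y3; Z3; None]) b)%S,
      d3 v o4_2 = (pull (lmap [:: None; X3; Y3; Z3]) b
                   + - pull (lmap [:: X3; X3; Y3; Z3]) b
                   + pull (lmap [:: X3; Y3; Y3; Z3]) b
                   + - pull (lmap [:: X3; Y3; Z3; Z3]) c
                   + pull (lmap [:: X3; Y3; Z3; None]) c)%S &
      d3 v o4_3 = (pull (lmap [:: None; X3; Y3; Z3]) c
                   + - pull (lmap [:: X3; X3; Y3; Z3]) c
                   + pull (lmap [:: X3; Y3; Y3; Z3]) c
                   + - pull (lmap [:: X3; Y3; Z3; Z3]) c
                   + szero 4)%S].
Proof.
rewrite /d3 /tadd /topp /u_2_3_4 /u_12_3_4 /u_1_23_4 /u_1_2_34 /u_1_2_3.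
rewrite /coface /=.
by split; do !congr (sadd _ _); try congr (sopp _); rewrite //;
  apply: ssubst_pull; apply: ord4_case; apply: ord3_case.
Qed.

Lemma d3_d2 (u : tup k 2) : d3 (d2 u) = tzero 4.
Proof.
apply: functional_extensionality => j; apply: functional_extensionality => w.
have [e0 e1 e2 e3] := d3E (d2 u); have [f0 f1 f2] := d2E u.
by move: j; apply: ord4_case; rewrite ?e0 ?e1 ?e2 ?e3 ?f0 ?f1 ?f2;
  rewrite !(pullD, pullN, pull0, pull_lmap) /= /sadd /sopp /tzero /szero; ring.
Qed.

Lemma d3D (v w : tup k 3) : d3 (tadd v w) = tadd (d3 v) (d3 w).
Proof.
apply: functional_extensionality => j; apply: functional_extensionality => l.
have [e0 e1 e2 e3] := d3E (tadd v w).
have [f0 f1 f2 f3] := d3E v; have [g0 g1 g2 g3] := d3E w.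
by rewrite [RHS]/tadd; move: j; apply: ord4_case;
  rewrite ?e0 ?e1 ?e2 ?e3 ?f0 ?f1 ?f2 ?f3 ?g0 ?g1 ?g2 ?g3 /tadd;
  rewrite !pullD /sadd /sopp /szero; ring.
Qed.

Lemma d3N (v : tup k 3) : d3 (topp v) = topp (d3 v).
Proof.
apply: functional_extensionality => j; apply: functional_extensionality => l.
have [e0 e1 e2 e3] := d3E (topp v); have [f0 f1 f2 f3] := d3E v.
by rewrite [RHS]/topp; move: j; apply: ord4_case;
  rewrite ?e0 ?e1 ?e2 ?e3 ?f0 ?f1 ?f2 ?f3 /topp;
  rewrite !pullN /sadd /sopp /szero; ring.
Qed.

Lemma is_tder_d2 (u : tup k 2) : is_tder u -> is_tder (d2 u).
Proof.
move=> Tu; have [La a0] := Tu o2_0; have [Lb b0] := Tu o2_1.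
have [f0 f1 f2] := d2E u.
apply: ord3_case; rewrite ?f0 ?f1 ?f2; split;
  try by repeat first [apply: is_lieD | apply: is_lieN | apply: is_lie_pull
                      | apply: is_lie0].
all: by rewrite /sadd /sopp /szero /pull /= ?a0 ?b0; ring.
Qed.

Lemma pull_same m n (s : seq (option 'I_n)) i (f : series k n) w :
  is_lie f -> all (pred2 None (Some i)) s -> size w != 1 ->
  pull (lmap (m := m) s) f w = 0.
Proof.
move=> Lf /allP si w1; rewrite /pull; case: ifP => // sw.
suff -> : pmap (lmap s) w = nseq (size w) i by apply: is_lie_const.
elim: w {w1} sw => //= a w IH /andP [sa /IH ->].
move: sa => /=; case E: (nth None s a) => [b|] // _.
have sb : Some b \in s.
  rewrite -E mem_nth // ltnNge; apply/negP => /(nth_default None).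
  by rewrite E.
by have /= /eqP [->] := si _ sb.
Qed.

Lemma pull_homog m n (p : 'I_m -> option 'I_n) d (f : series k n) w :
  (forall v, size v != d -> f v = 0) -> size w != d -> pull p f w = 0.
Proof.
move=> f0 wd; rewrite /pull; case: ifP => // pw; apply: f0.
by rewrite size_pmap; move: pw; rewrite all_count => /eqP ->.
Qed.

Lemma sgen_size n (i : 'I_n) (c : k) v :
  size v != 1 -> sscale c (sgen i) v = 0.
Proof.
by move=> v1; rewrite /sscale /sgen; case: eqP => [vE|_]; [rewrite vE in v1 | rewrite mulr0].
Qed.

Lemma sbr_gen_size n (i j : 'I_n) (c : k) v :
  size v != 2 -> sscale c (sbr (sgen i) (sgen j)) v = 0.
Proof.
move=> v2; rewrite /sscale sbr_gen.
by do 2 (case: eqP => [vE|_]; first by rewrite vE in v2); rewrite subrr mulr0.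
Qed.

Lemma is_lie_gen n (i : 'I_n) : is_lie (@sgen k n i).
Proof.
apply: (@is_lie_homog _ _ 1) => [|w w1]; first exact: lie_poly_gen.
by rewrite -(sgen_size i 1 w1) /sscale mul1r.
Qed.

Lemma is_lie_br_gen n (i j : 'I_n) : is_lie (@sbr k n (sgen i) (sgen j)).
Proof.
apply: (@is_lie_homog _ _ 2) => [|w w1].
  by apply: lie_poly_br; apply: lie_poly_gen.
by rewrite -(sbr_gen_size i j 1 w1) /sscale mul1r.
Qed.

Lemma is_tderD n (u v : tup k n) : is_tder u -> is_tder v -> is_tder (tadd u v).
Proof.
move=> Tu Tv i; have [Lu u0] := Tu i; have [Lv v0] := Tv i.
by split; [apply: is_lieD | rewrite /tadd /sadd u0 v0 addr0].
Qed.

Lemma is_tderN n (u : tup k n) : is_tder u -> is_tder (topp u).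
Proof.
move=> Tu i; have [Lu u0] := Tu i.
by split; [apply: is_lieN | rewrite /topp /sopp u0 oppr0].
Qed.

Lemma lmap_id2 (f : series k 2) : pull (lmap [:: X2; Y2]) f = f.
Proof. by rewrite -[RHS]pull_id; apply: pull_ext; apply: ord2_case. Qed.

Lemma lmap_id3 (f : series k 3) : pull (lmap [:: X3; Y3; Z3]) f = f.
Proof. by rewrite -[RHS]pull_id; apply: pull_ext; apply: ord3_case. Qed.

Lemma d2_fst_eq0 (u : tup k 2) : is_lie (u o2_0) -> d2 u o3_0 = szero 3 ->
  u o2_0 = sscale (u o2_0 [:: o2_1]) (sgen o2_1).
Proof.
have [-> _ _] := d2E u; move: (u o2_0) => a La.
move=> /(congr1 (pull (lmap (m := 2) [:: Y3; Z3]))).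
rewrite !(pullD, pullN, pull0, pull_lmap) /= lmap_id2 => E.
apply: functional_extensionality => w; move/(congr1 (fun f => f w)): E.
rewrite /sadd /sopp /szero; have [|w1] := eqVneq (size w) 1.
  case: w => [|i [|]] // _; rewrite /sscale /sgen.
  move: i; apply: ord2_case; rewrite /pull /= ?mulr1 // addrK add0r mulr0.
  by move/eqP; rewrite oppr_eq0 => /eqP.
rewrite (@pull_same _ _ _ o2_1) // (@pull_same _ _ _ o2_1) // sgen_size //.
by rewrite add0r addr0 subr0 => /eqP; rewrite oppr_eq0 => /eqP.
Qed.

Lemma d2_snd_eq0 (u : tup k 2) : is_lie (u o2_1) -> d2 u o3_2 = szero 3 ->
  u o2_1 = sscale (u o2_1 [:: o2_0]) (sgen o2_0).
Proof.
have [_ _ ->] := d2E u; move: (u o2_1) => b Lb.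
move=> /(congr1 (pull (lmap (m := 2) [:: X3; Y3]))).
rewrite !(pullD, pullN, pull0, pull_lmap) /= lmap_id2 => E.
apply: functional_extensionality => w; move/(congr1 (fun f => f w)): E.
rewrite /sadd /sopp /szero; have [|w1] := eqVneq (size w) 1.
  case: w => [|i [|]] // _; rewrite /sscale /sgen.
  by move: i; apply: ord2_case; rewrite /pull /= ?mulr1 // subrr add0r subr0 mulr0.
rewrite (@pull_same _ _ _ o2_0) // (@pull_same _ _ _ o2_0) // sgen_size //.
by rewrite !subr0 !add0r.
Qed.

Lemma d2_gens (u : tup k 2) c d : u o2_0 = sscale c (sgen o2_1) ->
  u o2_1 = sscale d (sgen o2_0) -> d2 u = tzero 3.
Proof.
move=> a0 b0; apply: functional_extensionality => j.
apply: functional_extensionality => w; have [f0 f1 f2] := d2E u.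
have [|w1] := eqVneq (size w) 1; last first.
  have P i (e : k) s : pull (lmap (m := 3) (n := 2) s) (sscale e (sgen i)) w = 0.
    by apply: (@pull_homog _ _ _ 1) => // v; apply: sgen_size.
  by move: j; apply: ord3_case; rewrite ?f0 ?f1 ?f2 ?a0 ?b0 /sadd /sopp !P
     /tzero /szero; ring.
case: w => [|i [|]] // _.
by move: j; apply: ord3_case; rewrite ?f0 ?f1 ?f2 ?a0 ?b0 /sadd /sopp /tzero
  /szero; move: i; apply: ord3_case;
  rewrite /pull /= /sscale /sgen ?eqseq_cons /=; ring.
Qed.

Lemma d3_mid_ker (v : tup k 3) (chark0 : [pchar k] =i pred0) :
  is_lie (v o3_1) -> v o3_0 = szero 3 -> v o3_2 = szero 3 -> d3 v = tzero 4 ->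
  exists c, v o3_1 = sscale c (sbr (sgen o3_2) (sgen o3_0)).
Proof.
have [_ e1 e2 _] := d3E v; move=> Lb a0 c0 dv.
rewrite a0 c0 dv in e1 e2; move: (v o3_1) Lb e1 e2 => b Lb.
move=> /(congr1 (pull (lmap (m := 3) [:: Some o4_0; Some o4_2; Some o4_3]))) E1.
move=> /(congr1 (pull (lmap (m := 3) [:: Some o4_0; Some o4_1; Some o4_3]))) E2.
rewrite !(pullD, pullN, pull0, pull_lmap) /= lmap_id3 in E1 E2.
pose h : series k 2 := pull (lmap [:: X3; Z3]) b.
have bE : b = sadd (pull (lmap [:: X2; Y2; Y2]) h)
                   (sopp (pull (lmap [:: X2; Y2; None]) h)).
  apply: functional_extensionality => w; have := congr1 (fun f => f w) E1.
  rewrite /h !pull_lmap /= /sadd /sopp /szero => e.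
  by apply/eqP; rewrite -subr_eq0; apply/eqP; apply: etrans (esym e); ring.
have hZ : h = sscale (h [:: o2_0; o2_1]) (sbr (sgen o2_0) (sgen o2_1)).
  apply: lie_cocycle => // [|w]; first exact: is_lie_pull.
  have := congr1 (fun f => f w) E1; have := congr1 (fun f => f w) E2.
  rewrite /h !pull_lmap /= /sadd /sopp /szero => e2 e1.
  have := esym (f_equal2 (fun x y => x - y) e2 e1); rewrite subrr => e.
  by apply: etrans e; ring.
rewrite bE hZ.
move: (h _) => c; exists (- c); apply: functional_extensionality => w.
rewrite /sadd /sopp; have [|w2] := eqVneq (size w) 2; last first.
  rewrite sbr_gen_size // !(@pull_homog _ _ _ 2) ?subrr // => u;
    exact: sbr_gen_size.
case: w => [|i [|j [|]]] // _.
by move: i; apply: ord3_case; move: j; apply: ord3_case;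
  rewrite /pull /= /sscale !sbr_gen ?eqseq_cons /=; ring.
Qed.

Lemma is_tder_c_elt : is_tder (c_elt k).
Proof.
by apply: ord3_case; split; rewrite /c_elt /= ?sbr_gen ?subrr //;
  first [exact: is_lie0 | exact: is_lie_br_gen].
Qed.

Lemma d3_c_elt : d3 (c_elt k) = tzero 4.
Proof.
apply: functional_extensionality => j; apply: functional_extensionality => w.
have [e0 e1 e2 e3] := d3E (c_elt k).
have [|w2] := eqVneq (size w) 2; last first.
  have P s : pull (lmap s) (sbr (sgen o3_2) (sgen o3_0)) w = 0 :> k.
    apply: (@pull_homog _ _ _ 2) => // v v2.
    by rewrite -(sbr_gen_size o3_2 o3_0 1 v2) /sscale mul1r.
  by move: j; apply: ord4_case; rewrite ?e0 ?e1 ?e2 ?e3 /c_elt /= ?pull0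
    /sadd /sopp ?P /tzero /szero; ring.
case: w => [|a [|b [|]]] // _.
by move: j; apply: ord4_case; rewrite ?e0 ?e1 ?e2 ?e3 /c_elt /= ?pull0
    /sadd /sopp /tzero /szero; move: a b; apply: ord4_case; apply: ord4_case;
  rewrite /pull /= ?sbr_gen ?eqseq_cons /=; ring.
Qed.

Lemma c_elt_notin_im : ~ exists u : tup k 2, is_tder u /\ d2 u = c_elt k.
Proof.
case=> u [Tu du]; have [La _] := Tu o2_0; have [Lb _] := Tu o2_1.
have := d2_gens (d2_fst_eq0 La (congr1 (fun f => f o3_0) du))
                (d2_snd_eq0 Lb (congr1 (fun f => f o3_2) du)).
rewrite du => /(congr1 (fun f => f o3_1 [:: o3_2; o3_0])) /eqP.
by rewrite /c_elt /= sbr_gen /tzero /szero /= subr0 oner_eq0.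
Qed.

Lemma ker_d3 (chark0 : [pchar k] =i pred0) (v : tup k 3) :
  is_tder v -> d3 v = tzero 4 ->
  exists (a : k) (u : tup k 2),
    is_tder u /\ v = tadd (tscale a (c_elt k)) (d2 u).
Proof.
move=> Tv dv; have [La _] := Tv o3_0; have [Lc _] := Tv o3_2.
have [e0 _ _ e3] := d3E v; rewrite dv in e0 e3.
move: e0 => /(congr1 (pull (lmap (m := 3) [:: Some o4_1; Some o4_2; Some o4_3]))) E0.
move: e3 => /(congr1 (pull (lmap (m := 3) [:: Some o4_0; Some o4_1; Some o4_2]))) E3.
rewrite !(pullD, pullN, pull0, pull_lmap) /= !lmap_id3 in E0 E3.
pose u : tup k 2 := fun i => if val i is 0 then sopp (pull (lmap [:: Y3; Z3]) (v o3_0))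
                             else pull (lmap [:: X3; Y3]) (v o3_2).
have Tu : is_tder u.
  apply: ord2_case; split; rewrite /u /=.
  - by apply: is_lieN; apply: is_lie_pull.
  - have [_ a0] := Tv o3_0; have := congr1 (fun f => f [:: o3_0]) E0.
    rewrite /sadd /sopp /pull /= a0 => e.
    by apply: oppr_inj; rewrite oppr0; apply: etrans (esym e); rewrite /szero; ring.
  - exact: is_lie_pull.
  - have [_ c0] := Tv o3_2; have := congr1 (fun f => f [:: o3_2]) E3.
    rewrite /sadd /sopp /pull /= c0 => e.
    by apply: etrans (esym e); rewrite /szero; ring.
have [f0 _ f2] := d2E u.
pose v' := tadd v (topp (d2 u)).
have v'0 : v' o3_0 = szero 3.
  apply: functional_extensionality => w; have := congr1 (fun f => f w) E0.
  rewrite /v' /tadd /topp f0 /u /= !(pullN, pull_lmap) /= /sadd /sopp /szero => e.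
  by apply: oppr_inj; rewrite oppr0; apply: etrans (esym e); ring.
have v'2 : v' o3_2 = szero 3.
  apply: functional_extensionality => w; have := congr1 (fun f => f w) E3.
  rewrite /v' /tadd /topp f2 /u /= !pull_lmap /= /sadd /sopp /szero => e.
  by apply: oppr_inj; rewrite oppr0; apply: etrans (esym e); ring.
have dv' : d3 v' = tzero 4.
  rewrite d3D d3N d3_d2 dv; apply: functional_extensionality => j.
  by apply: functional_extensionality => w; rewrite /tadd /topp /sadd /sopp subrr.
have Tv' : is_tder v' by apply: is_tderD => //; apply/is_tderN/is_tder_d2.
have [c cE] := d3_mid_ker chark0 (Tv' o3_1).1 v'0 v'2 dv'.
exists c, u; split=> //; apply: functional_extensionality => j.
apply: functional_extensionality => w.
have vE i : v i w = v' i w + d2 u i w by rewrite /v' /tadd /topp /sadd /sopp subrK.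
rewrite vE /tadd /sadd; congr (_ + _); rewrite /tscale /c_elt.
by move: j; apply: ord3_case; rewrite /= ?v'0 ?v'2 ?cE // /sscale /szero mulr0.
Qed.

Lemma ker_d2 (u : tup k 2) :
  (is_tder u /\ d2 u = tzero 3) <->
  (exists a b : k, u = tadd (tscale a (r_elt k)) (tscale b (t_elt k))).
Proof.
split=> [[Tu du]|[a [b ->]]].
  have [La _] := Tu o2_0; have [Lb _] := Tu o2_1.
  have aE := d2_fst_eq0 La (congr1 (fun f => f o3_0) du).
  have bE := d2_snd_eq0 Lb (congr1 (fun f => f o3_2) du).
  exists (u o2_0 [:: o2_1] - u o2_1 [:: o2_0]), (u o2_1 [:: o2_0]).
  apply: functional_extensionality; apply: ord2_case.
    rewrite {1}aE; apply: functional_extensionality => w.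
    by rewrite /tadd /tscale /r_elt /t_elt /sadd /sscale /=; ring.
  rewrite {1}bE; apply: functional_extensionality => w.
  by rewrite /tadd /tscale /r_elt /t_elt /sadd /sscale /szero /=; ring.
split; last first.
  apply: (@d2_gens _ (a + b) b); apply: functional_extensionality => w.
    by rewrite /tadd /tscale /r_elt /t_elt /sadd /sscale /=; ring.
  by rewrite /tadd /tscale /r_elt /t_elt /sadd /sscale /szero /=; ring.
apply: ord2_case; split; rewrite /tadd /tscale /r_elt /t_elt /=;
  try by apply: is_lieD; apply: is_lieZ; first [exact: is_lie0 | exact: is_lie_gen].
all: by rewrite /sadd /sscale /sgen /szero /= !mulr0 addr0.
Qed.

Lemma r_t_free (a b : k) :
  tadd (tscale a (r_elt k)) (tscale b (t_elt k)) = tzero 2 -> a = 0 /\ b = 0.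
Proof.
move=> e; have b0 : b = 0.
  have := congr1 (fun f => f o2_1 [:: o2_0]) e.
  by rewrite /tadd /tscale /sadd /sscale /sgen /szero /= mulr0 mulr1 add0r.
split=> //; have := congr1 (fun f => f o2_0 [:: o2_1]) e.
by rewrite /tadd /tscale /sadd /sscale /sgen /= b0 mulr1 mul0r addr0.
Qed.

End Differentials.

Theorem theorem3p16 (k : fieldType) (chark0 : [pchar k] =i pred0) :
  (* (1) ker(d : tder_2 -> tder_3) = k r (+) k t *)
  (forall u : tup k 2,
      (is_tder u /\ d2 u = @tzero k 3) <->
      (exists a b : k, u = tadd (tscale a (r_elt k)) (tscale b (t_elt k))))
  /\ (forall a b : k,
        tadd (tscale a (r_elt k)) (tscale b (t_elt k)) = @tzero k 2 -> a = 0 /\ b = 0)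
  (* (2) ker(d : tder_3 -> tder_4) / im(d : tder_2 -> tder_3) is
         one-dimensional, spanned by the class of c = (0,[z,x],0) *)
  /\ (forall u : tup k 2, is_tder u -> is_tder (d2 u) /\ d3 (d2 u) = @tzero k 4)
  /\ (is_tder (c_elt k) /\ d3 (c_elt k) = @tzero k 4)
  /\ ~ (exists u : tup k 2, is_tder u /\ d2 u = c_elt k)
  /\ (forall v : tup k 3, is_tder v -> d3 v = @tzero k 4 ->
        exists (a : k) (u : tup k 2), is_tder u /\ v = tadd (tscale a (c_elt k)) (d2 u)).
Proof.
split; first exact: ker_d2.
split; first exact: r_t_free.
split; first by move=> u Tu; split; [apply: is_tder_d2 | apply: d3_d2].
split; first by split; [apply: is_tder_c_elt | apply: d3_c_elt].
split; first exact: c_elt_notin_im.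
exact: ker_d3.
Qed.
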